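(* For every integer $m\ge 9$, $$\hat{r}_c(3K_2,P_m)\le\left\lceil\frac{3m+7}{2}\right\rceil.$$
   Context: All graphs are finite and simple. The size $e(F)$ of a graph $F$ is its number of edges. For graphs $F,G,H$, write $F\to(G,H)$ if for every coloring of the edges of $F$ with the colors red and blue, $F$ contains either a subgraph isomorphic to $G$ all of whose edges are red, or a subgraph isomorphic to $H$ all of whose edges are blue (subgraphs are not necessarily induced). The connected size Ramsey number $\hat{r}_c(G,H)$ is the smallest possible size of a connected graph $F$ with $F\to(G,H)$. $P_m$ denotes the path on $m$ vertices (with $m-1$ edges), and $3K_2$ is the disjoint union of three edges (a matching of size 3). *)

(* Defs.v *)
From mathcomp Require Import all_boot.
Set Implicit Arguments.
Unset Strict Implicit.
Unset Printing Implicit Defensive.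

Record sgraph := SGraph {
  vertex :> finType;
  adj : rel vertex;
  adj_sym : symmetric adj;
  adj_irrefl : irreflexive adj }.

Definition edges (F : sgraph) : {set {set F}} :=
  [set [set p.1; p.2] | p : F * F & adj p.1 p.2].

Definition size_graph (F : sgraph) : nat := #|edges F|.

Definition connected_graph (F : sgraph) : Prop :=
  0 < #|F| /\ forall x y : F, connect (@adj F) x y.

(* F has a (not necessarily induced) subgraph isomorphic to G: the image of
   an injective homomorphism. *)
Definition has_copy (F G : sgraph) : Prop :=
  exists2 f : G -> F, injective f & {homo f : x y / adj x y}.

Definition color_adj (F : sgraph) (c : {set F} -> bool) (b : bool) : rel F :=
  [rel x y : F | adj x y && (c [set x; y] == b)].

Lemma color_adj_sym (F : sgraph) (c : {set F} -> bool) (b : bool) :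
  symmetric (color_adj c b).
Proof. by move=> x y; rewrite /color_adj /= adj_sym setUC. Qed.

Lemma color_adj_irrefl (F : sgraph) (c : {set F} -> bool) (b : bool) :
  irreflexive (color_adj c b).
Proof. by move=> x; rewrite /color_adj /= adj_irrefl. Qed.

Definition color_class (F : sgraph) (c : {set F} -> bool) (b : bool) : sgraph :=
  SGraph (color_adj_sym c b) (color_adj_irrefl c b).

(* F -> (G, H), with true for red and false for blue. Only the values of the
   coloring c on edges F matter. *)
Definition arrows (F G H : sgraph) : Prop :=
  forall c : {set F} -> bool,
    has_copy (color_class c true) G \/ has_copy (color_class c false) H.

(* r is the smallest size of a connected graph F with F -> (G, H). As a
   relation, it carries the existence of such an F. *)
Definition is_connected_size_ramsey (G H : sgraph) (r : nat) : Prop :=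
  (exists F : sgraph,
     [/\ connected_graph F, arrows F G H & size_graph F = r]) /\
  (forall F : sgraph, connected_graph F -> arrows F G H -> r <= size_graph F).

Definition path_adj (m : nat) : rel 'I_m :=
  [rel i j : 'I_m | (i.+1 == j) || (j.+1 == i)].

Lemma path_adj_sym (m : nat) : symmetric (@path_adj m).
Proof. by move=> i j; rewrite /path_adj /= orbC. Qed.

Lemma path_adj_irrefl (m : nat) : irreflexive (@path_adj m).
Proof. by move=> i; rewrite /path_adj /= orbb gtn_eqF. Qed.

Definition path_graph (m : nat) : sgraph :=
  SGraph (@path_adj_sym m) (@path_adj_irrefl m).

(* n K_2: the i-th edge joins (i, false) and (i, true). *)
Definition matching_adj (n : nat) : rel ('I_n * bool) :=
  [rel x y : 'I_n * bool | (x.1 == y.1) && (x.2 != y.2)].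

Lemma matching_adj_sym (n : nat) : symmetric (@matching_adj n).
Proof. by move=> x y; rewrite /matching_adj /= eq_sym [x.2 == _]eq_sym. Qed.

Lemma matching_adj_irrefl (n : nat) : irreflexive (@matching_adj n).
Proof. by move=> x; rewrite /matching_adj /= !eqxx. Qed.

Definition matching_graph (n : nat) : sgraph :=
  SGraph (@matching_adj_sym n) (@matching_adj_irrefl n).

(* Main.v *)
Require Import Defs.
From mathcomp Require Import all_boot.
From mathcomp Require Import zify.
From Stdlib Require Import Classical.
Set Implicit Arguments.
Unset Strict Implicit.
Unset Printing Implicit Defensive.

(** The witness on n = m + 2 vertices is a ladder whose rails join u to u + 2
and whose rungs join 2k to 2k + 1, closed up by three edges 0 -- n-1,
1 -- n-1 and t -- n-2, where t is 2 or 3 according to n mod 4. It has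
n + n/2 + 1 edges.

A red graph without three disjoint edges either is covered by two vertices, or
consists of a triangle and a star, or contains two triangles, or lies on the
vertices of a 5-cycle. So it suffices that the ladder keeps a path on n - 2
vertices after removing any two vertices, or the edges of its only triangle
and one vertex, or the edges on any of its 5-cycles. For n <= 20 this is
computed. For larger n two consecutive inner columns avoid the removed
vertices, because the triangle and the 5-cycles stay near the closing edges;
contracting the two columns gives the graph on n - 4 vertices, and its path
can be extended through the four new vertices: along the rails it uses, or
by a detour at a rung, or at an end of the path. *)

(** * Graphs without three disjoint edges *)

Definition no_matching3 (T : eqType) (R : rel T) := forall a b c d e f : T,
  R a b -> R c d -> R e f -> ~~ uniq [:: a; b; c; d; e; f].

Definition covers2 (T : eqType) (R : rel T) u v :=
  forall x y, R x y -> (x \in [:: u; v]) || (y \in [:: u; v]).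

Definition triangle (T : eqType) (R : rel T) a b c := [&& R a b, R b c & R c a].

Definition two_triangles (T : eqType) (R : rel T) := exists a b c p q r,
  [/\ triangle R a b c, triangle R p q r & p \notin [:: a; b; c]].

Definition covers_triangle (T : eqType) (R : rel T) a b c v :=
  forall x y, R x y ->
  [|| (x \in [:: a; b; c]) && (y \in [:: a; b; c]), x == v | y == v].

Definition cycle5 (T : eqType) (R : rel T) a b c d e :=
  uniq [:: a; b; c; d; e] && [&& R a b, R b c, R c d, R d e & R e a].

Definition within (T : eqType) (R : rel T) (s : seq T) :=
  forall x y, R x y -> (x \in s) && (y \in s).

Section RedStructure.
Variables (T : eqType) (R : rel T).
Hypotheses (symR : symmetric R) (irrR : irreflexive R) (free3 : no_matching3 R).

Lemma edge_neq x y : R x y -> x != y.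
Proof. by apply: contraTneq => ->; rewrite irrR. Qed.

Ltac neq := first [ done | by rewrite eq_sym | by apply: edge_neq
  | by apply: edge_neq; rewrite symR ].
Ltac distinct := rewrite /= ?inE ?negb_or; repeat (apply/andP; split); neq.
Ltac matching a b c d e f :=
  exfalso; suff: uniq [:: a; b; c; d; e; f];
    [apply/negP; apply: free3; neq | distinct].

Definition matching_off v := exists a b c d,
  [/\ R a b, R c d & uniq [:: v; a; b; c; d]].

(** The edges that miss [v] pairwise meet, so they form a star, whose centre is [w], or a
    triangle. *)
Lemma no_matching_off v : ~ matching_off v ->
  (exists w, covers2 R v w) \/
  exists a b c, triangle R a b c /\ covers_triangle R a b c v.
Proof.
move=> noM.
have meet a b c d : R a b -> R c d -> a != v -> b != v -> c != v -> d != v ->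
    [|| c == a, c == b, d == a | d == b].
  move=> ab cd av bv cv dv; apply: contra_notT noM; rewrite !negb_or.
  case/and4P=> ca cb da db; exists a, b, c, d; split=> //; distinct.
have [[x [y [xy xv yv]]]|no_edge] :=
  classic (exists x y, [/\ R x y, x != v & y != v]); last first.
  left; exists v => x y xy; rewrite !inE !orbb.
  by apply/norP => -[xv yv]; apply: no_edge; exists x, y.
(* Either [x'] is the centre of the star, or some edge misses both [v] and [x'] and then has to pass
   through [y']. *)
have third x' y' : R x' y' -> x' != v -> y' != v ->
    (exists z, [/\ R y' z, z != x' & z != v]) \/ (exists w, covers2 R v w).
  move=> x'y' xv' yv'.
  have [[p [q [pq pv qv px qx]]]|no_edge] := classic (exists p q,
      [/\ R p q, p != v, q != v, p != x' & q != x']); last first.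
    right; exists x' => p q pq; rewrite !inE; apply/norP => -[].
    by rewrite !negb_or => /andP[pv px] /andP[qv qx]; apply: no_edge; exists p, q.
  left; have := meet _ _ _ _ x'y' pq xv' yv' pv qv.
  rewrite (negPf px) (negPf qx) /= => /orP[]/eqP e; first by exists q; rewrite -e.
  by exists p; rewrite -e symR.
have [[z [yz zx zv]]|] := third x y xy xv yv; last by left.
have yx : R y x by rewrite symR.
have [[w [xw wy wv]]|] := third y x yx yv xv; last by left.
(* The edges [y z] and [x w] both miss [v], so they meet, and only [z = w] is possible. *)
have /eqP zw : z == w.
  have yNx := edge_neq xy; have yNz := edge_neq yz; have xNw := edge_neq xw.
  have := meet _ _ _ _ yz xw yv zv xv wv.
  by rewrite (negPf wy) (negPf yNx) (eq_sym x z) (negPf zx) /= eq_sym.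
subst w; right; exists x, y, z; split; first by rewrite /triangle xy yz symR.
move=> p q pq; apply/or3P.
have [->|pv] := eqVneq p v; first by constructor 2.
have [->|qv] := eqVneq q v; first by constructor 3.
constructor 1.
have xNy := edge_neq xy; have yNz := edge_neq yz; have xNz := edge_neq xw.
have := meet _ _ _ _ xy pq xv yv pv qv; have := meet _ _ _ _ yz pq yv zv pv qv.
have := meet _ _ _ _ xw pq xv zv pv qv; rewrite !inE.
have two u : (u == x) + (u == y) + (u == z) <= 1.
  have [->|_] := eqVneq u x; first by rewrite (negPf xNy) (negPf xNz).
  by have [->|_] := eqVneq u y; rewrite ?(negPf yNz) //; case: (_ == z).
move: (two p) (two q).
by case: (p == x); case: (p == y); case: (p == z);
   case: (q == x); case: (q == y); case: (q == z).
Qed.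

(** A vertex of the cycle can be left out so that the other four carry two disjoint edges of the
    cycle. An edge leaving the cycle at that vertex, or missing the cycle altogether, would be a
    third one. *)
Lemma cycle5_within a b c d e : cycle5 R a b c d e -> within R [:: a; b; c; d; e].
Proof.
rewrite /cycle5 /= !inE !negb_or -!andbA.
case/and5P=> ab ac ad ae /and5P[bc bd be cd] /and5P[ce de _ Rab] /and4P[Rbc Rcd Rde Rea].
suff half x y : R x y -> x \in [:: a; b; c; d; e] ->
    y \in [:: a; b; c; d; e].
  move=> x y xy; have [xS|xS] := boolP (x \in _).
    by rewrite (half x y).
  have [yS|yS] := boolP (y \in [:: a; b; c; d; e]).
    by rewrite symR in xy; rewrite (half y x) in xS.
  move: xS yS; rewrite !inE !negb_or => /and5P[xa xb xc xd xe] /and5P[ya yb yc yd ye].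
  matching x y a b c d.
move=> xy xS; apply: contraT => yS.
move: yS; rewrite !inE !negb_or => /and5P[ya yb yc yd ye].
move: xS; rewrite !inE; case/or4P=> [|||/orP[]] /eqP e0; subst x.
- matching a y b c d e.
- matching b y c d e a.
- matching c y d e a b.
- matching d y e a b c.
- matching e y a b c d.
Qed.

(** The matching [a b], [c d] is maximum, and another matching of the same size misses [a]. Their
    symmetric difference contains an alternating path of even length from [a] to a vertex [x] missed
    by the first matching: [a b x], [a b c d x] or [a b d c x]. *)
Lemma even_alternating_path a b c d : R a b -> R c d -> uniq [:: a; b; c; d] ->
  matching_off a ->
  exists2 x, x \notin [:: a; b; c; d] &
    [|| R b x, R b c && R d x | R b d && R c x].
Proof.
move=> ab cd; rewrite /= !inE !negb_or => /and4P[/and3P[aNb aNc aNd]].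
move=> /andP[bNc bNd] cNd _ [p [q [r [s [pq rs]]]]].
rewrite /= !inE !negb_or => /and5P[/and4P[ap aq ar as_] /and3P[pNq pNr pNs]].
move=> /andP[qNr qNs] rNs _.
have touch u v : R u v -> a != u -> a != v ->
    (u \in [:: b; c; d]) || (v \in [:: b; c; d]).
  move=> uv au av; rewrite !inE; apply/norP; rewrite !negb_or => -[].
  case/and3P=> ub uc ud /and3P[vb vc vd].
  matching a b c d u v.
have out z : a != z -> z \notin [:: b; c; d] -> z \notin [:: a; b; c; d].
  by move=> az zS; rewrite in_cons negb_or eq_sym az.
(* Here [u x] and [u' w] are the two edges of the second matching, and [x] lies outside the first
   one. *)
have key u x u' w : R u x -> R u' w -> a != x -> a != w -> u != u' -> u != w ->
    x != u' -> x != w -> x \notin [:: b; c; d] ->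
    u \in [:: b; c; d] -> u' \in [:: b; c; d] ->
    exists2 x, x \notin [:: a; b; c; d] &
      [|| R b x, R b c && R d x | R b d && R c x].
  move=> ux u'w ax aw uu' uw xu' xw xS uS u'S.
  have [wS|wS] := boolP (w \in [:: b; c; d]).
    exists x; first exact: out.
    move: uS u'S wS; rewrite !inE.
    case/or3P=> /eqP ?; subst u; first by rewrite ux.
      case/or3P=> /eqP ?; subst u'; rewrite ?eqxx // in uu';
      case/or3P=> /eqP ?; subst w; rewrite ?eqxx // in uw.
      + by rewrite irrR in u'w.
      + by rewrite u'w ux !orbT.
      + by rewrite (symR b d) u'w ux !orbT.
      + by rewrite irrR in u'w.
    case/or3P=> /eqP ?; subst u'; rewrite ?eqxx // in uu';
    case/or3P=> /eqP ?; subst w; rewrite ?eqxx // in uw.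
    + by rewrite irrR in u'w.
    + by rewrite u'w ux !orbT.
    + by rewrite (symR b c) u'w ux !orbT.
    + by rewrite irrR in u'w.
  have [ub|ub] := eqVneq u b.
    by exists x; [exact: out | rewrite -ub ux].
  have [ub'|ub'] := eqVneq u' b.
    by exists w; [exact: out | rewrite -ub' u'w].
  move: xS wS; rewrite !inE !negb_or => /and3P[xb xc xd] /and3P[wb wc wd].
  move: uS u'S; rewrite !inE (negPf ub) (negPf ub') /=.
  case/orP=> /eqP ?; subst u; case/orP=> /eqP ?; subst u';
    rewrite ?eqxx // in uu'.
    matching a b c x d w.
  matching a b d x c w.
have := touch p q pq ap aq; have := touch r s rs ar as_.
have qp : R q p by rewrite symR.
have sr : R s r by rewrite symR.
have [qS|qS] := boolP (q \in [:: b; c; d]); last first.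
  rewrite orbF => rsS pS; case/orP: rsS => [rS|sS].
    apply: (key p q r s) => //; neq.
  apply: (key p q s r) => //; neq.
have [pS|pS] := boolP (p \in [:: b; c; d]); last first.
  move=> rsS _; case/orP: rsS => [rS|sS].
    apply: (key q p r s) => //; neq.
  apply: (key q p s r) => //; neq.
have [rS|rS] := boolP (r \in [:: b; c; d]); last first.
  move=> sS _; apply: (key s r p q) => //; neq.
have [sS|sS] := boolP (s \in [:: b; c; d]); last first.
  move=> _ _; apply: (key r s p q) => //; neq.
(* Two disjoint edges do not fit into the three vertices [b], [c], [d], so one of them leaves. *)
suff: 4 <= 3 by [].
apply: (@uniq_leq_size _ [:: p; q; r; s] [:: b; c; d]); first by distinct.
by apply/allP; rewrite /= pS qS rS sS.
Qed.

(** The alternating path from [d] has to end in [y], since otherwise [d y] would be one of three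
    disjoint edges. If it has length two, it gives [R c y]; if it has length four, the edge [d y]
    closes it to a 5-cycle. *)
Lemma partner_outside a b c d y : R a b -> R c d -> uniq [:: a; b; c; d] ->
  matching_off d -> y \notin [:: a; b; c; d] -> R d y ->
  R c y \/ exists p q r s t, cycle5 R p q r s t.
Proof.
move=> ab cd uabcd offd yS dy.
have [ba dc] : R b a /\ R d c by rewrite symR ab symR cd.
have [|x xS]:= even_alternating_path dc ab _ offd.
  move: uabcd; rewrite /= !inE !negb_or => /and4P[/and3P[? ? ?] /andP[? ?] ? _].
  by distinct.
move: uabcd yS xS; rewrite /= !inE !negb_or.
case/and4P=> /and3P[aNb aNc aNd] /andP[bNc bNd] cNd _.
case/and4P=> ya yb yc yd /and4P[xd xc xa xb].
case/or3P=> [cx|/andP[ca bx]|/andP[cb ax]].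
- have [<-|xy] := eqVneq x y; first by left.
  matching a b c x d y.
- have [?|xy] := eqVneq x y; last by matching c a b x d y.
  subst x; right; exists y, b, a, c, d; rewrite /cycle5 ba dy (symR y b) bx (symR a c) ca cd.
  by rewrite !andbT; distinct.
- have [?|xy] := eqVneq x y; last by matching c b a x d y.
  subst x; right; exists y, a, b, c, d; rewrite /cycle5 ab dy (symR y a) ax (symR b c) cb cd.
  by rewrite !andbT; distinct.
Qed.

(** Besides the triangle [a b x], alternating paths start at [c] and at [d]. If one of them passes
    to a new vertex at once, that vertex forms a triangle with [c d]. Otherwise [c] and [d] are
    joined to the same end of [a b], which gives a triangle, or to different ends, which gives a
    5-cycle through [x]. *)
Lemma two_triangles_or_cycle5 a b c d x : R a b -> R c d -> uniq [:: a; b; c; d] ->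
  matching_off c -> matching_off d -> x \notin [:: a; b; c; d] -> R a x -> R b x ->
  two_triangles R \/ exists p q r s t, cycle5 R p q r s t.
Proof.
move=> ab cd uabcd offc offd xS ax bx.
have [ba [dc [xa xb]]] : R b a /\ R d c /\ R x a /\ R x b.
  by rewrite !(symR x) symR ab symR cd.
have Tabx : triangle R a b x by rewrite /triangle ab bx xa.
move: (uabcd) (xS); rewrite /= !inE !negb_or.
case/and4P=> /and3P[aNb aNc aNd] /andP[bNc bNd] cNd _ /and4P[xNa xNb xNc xNd].
have ucdab : uniq [:: c; d; a; b] by distinct.
have udcab : uniq [:: d; c; a; b] by distinct.
have perm z : z \notin [:: c; d; a; b] -> z \notin [:: a; b; c; d].
  by rewrite !inE !negb_or => /and4P[-> -> -> ->].
have cTri z : z \notin [:: a; b; c; d] -> R d z -> R c z ->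
    two_triangles R.
  move=> zS dz cz; exists a, b, x, c, d, z; split=> //; first by rewrite /triangle cd dz symR.
  by distinct.
have [z zS] := even_alternating_path cd ab ucdab offc.
have [w wS] := even_alternating_path dc ab udcab offd.
have {}wS : w \notin [:: a; b; c; d].
  by move: wS; rewrite !inE !negb_or => /and4P[-> -> -> ->].
have {}zS := perm z zS.
case/or3P=> [cw|/andP[ca bw]|/andP[cb aw]].
- have ubadc : uniq [:: b; a; d; c] by distinct.
  have wS' : w \notin [:: b; a; d; c].
    by move: wS; rewrite !inE !negb_or => /and4P[? ? ? ?]; distinct.
  have [dw|] := partner_outside ba dc ubadc offc wS' cw; last by right.
  by left; apply: cTri dw cw.
- case/or3P=> [dz|/andP[da _]|/andP[db _]].
  + by have [cz|] := partner_outside ab cd uabcd offd zS dz; [left; apply: cTri dz cz | right].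
  + left; exists a, b, x, c, d, a; split=> //; last by distinct.
    by rewrite /triangle cd da symR.
  + right; exists x, a, c, d, b; rewrite /cycle5 xa (symR a c) ca cd db bx !andbT.
    by distinct.
- case/or3P=> [dz|/andP[da _]|/andP[db _]].
  + by have [cz|] := partner_outside ab cd uabcd offd zS dz; [left; apply: cTri dz cz | right].
  + right; exists x, b, c, d, a; rewrite /cycle5 xb (symR b c) cb cd da ax !andbT.
    by distinct.
  + left; exists a, b, x, c, d, b; split=> //; last by distinct.
    by rewrite /triangle cd db symR.
Qed.

(** If each vertex is missed by two disjoint edges, alternating paths complete an edge of a maximum
    matching to a triangle, unless a 5-cycle appears. The last two cases come from there, the first
    two from [no_matching_off]. *)
Lemma no_matching3_structure (x0 : T) :
  [\/ exists u v, covers2 R u v,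
      exists a b c v, triangle R a b c /\ covers_triangle R a b c v,
      two_triangles R
    | exists p q r s t, cycle5 R p q r s t].
Proof.
have [[v /no_matching_off]|off] := classic (exists v, ~ matching_off v).
  case=> [[w cvw]|[a [b [c abc]]]]; first by constructor 1; exists v, w.
  by constructor 2; exists a, b, c, v.
have {}off v : matching_off v by apply: NNPP => offv; apply: off; exists v.
have [a [b [c [d [ab cd /andP[_ uabcd]]]]]] := off x0.
suff: two_triangles R \/ exists p q r s t, cycle5 R p q r s t.
  by case; [constructor 3 | constructor 4].
have [ba dc] : R b a /\ R d c by rewrite symR ab symR cd.
have [x xS] := even_alternating_path ab cd uabcd (off a).
move: (uabcd) (xS); rewrite /= !inE !negb_or.
case/and4P=> /and3P[aNb aNc aNd] /andP[bNc bNd] cNd _ /and4P[xa xb xc xd].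
have ucdab : uniq [:: c; d; a; b] by distinct.
have via_cd : R c x -> R d x -> two_triangles R \/ exists p q r s t, cycle5 R p q r s t.
  by move=> cx dx; apply: (two_triangles_or_cycle5 cd ab ucdab _ _ _ cx dx) => //; distinct.
case/or3P=> [bx|/andP[_ dx]|/andP[_ cx]].
- have xS' : x \notin [:: c; d; a; b] by distinct.
  have [ax|] := partner_outside cd ab ucdab (off b) xS' bx; last by right.
  exact: (two_triangles_or_cycle5 ab cd uabcd (off c) (off d) xS ax bx).
- by have [cx|] := partner_outside ab cd uabcd (off d) xS dx; [apply: via_cd|right].
- have uabdc : uniq [:: a; b; d; c] by distinct.
  have xS' : x \notin [:: a; b; d; c] by distinct.
  by have [dx|] := partner_outside ab dc uabdc (off c) xS' cx; [apply: via_cd|right].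
Qed.

End RedStructure.

(** * Rerouting paths through new vertices *)

Section Insertion.
Variable T : eqType.
Implicit Types (E B : rel T) (w : seq T).

Definition link (a b : T) : rel T :=
  [rel x y | ((x == a) && (y == b)) || ((x == b) && (y == a))].

Lemma sorted_glue E w1 a w2 :
  sorted E (w1 ++ a :: w2) = sorted E (rcons w1 a) && path E a w2.
Proof. by case: w1 => //= x w1; rewrite -cat_rcons cat_path last_rcons. Qed.

Lemma sorted_flip E w : symmetric E -> sorted E (rev w) = sorted E w.
Proof. by move=> symE; rewrite rev_sorted; apply: eq_sorted => x y; rewrite symE. Qed.

(** A path traverses the extra edge at most once. A path that does so from [b] to [a] is reversed,
    so only [perm_eq] relates the parts to [w]. *)
Lemma sorted_split_link E a b w : symmetric E -> uniq w ->
  sorted (relU E (link a b)) w ->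
  sorted E w \/ exists w1 w2,
    [/\ perm_eq w (w1 ++ [:: a, b & w2]), sorted E (rcons w1 a) & path E b w2].
Proof.
move=> symE uw sw.
suff: sorted E w \/ exists w1 w2 u v, [/\ w = w1 ++ [:: u, v & w2],
    link a b u v, sorted E (rcons w1 u) & path E v w2].
  case=> [|[w1 [w2 [u [v [-> /orP[]/andP[/eqP-> /eqP->] s1 s2]]]]]]; [by left| |].
    by right; exists w1, w2.
  right; exists (rev w2), (rev w1); split.
  - by rewrite -(perm_rev (w1 ++ _)) rev_cat !rev_cons -!cats1 -!catA.
  - by rewrite -rev_cons sorted_flip.
  - by move: s1; rewrite -sorted_flip // rev_rcons.
elim: w uw sw => [|x [|y w] IHw] //=; [by left|by left|].
move=> /andP[xNyw uyw] /andP[/orP[xy|xy] sw].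
  have [s|[w1 [w2 [u [v [e uv s1 s2]]]]]] := IHw uyw sw.
    by left; rewrite xy.
  right; exists (x :: w1), w2, u, v; split=> //; first by rewrite e.
  by case: w1 e s1 => [[<- _]|z w1 [<- _]] /=; rewrite xy.
right; exists [::], w, x, y; split=> //.
apply: (@sub_in_sorted _ (mem (y :: w)) (relU E (link a b)) E _ (y :: w)) => //.
  move=> u v uw vw /orP[//|uv]; have : (x == u) || (x == v).
    by move: xy uv => /orP[]/andP[/eqP-> _] /orP[]/andP[/eqP-> /eqP->];
      rewrite eqxx ?orbT.
  by case/orP=> /eqP xu; move: xNyw;
    rewrite /= xu ?(uw : is_true (u \in y :: w)) ?(vw : is_true (v \in y :: w)).
exact/allP.
Qed.

(** An inner vertex of a path has two distinct neighbours on it, so [z] is an end, and reversing the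
    path if necessary puts it first. *)
Lemma path_end E z w : symmetric E -> uniq w -> sorted E w -> z \in w ->
  {in w &, forall u v, E z u -> E z v -> u = v} ->
  exists2 w', perm_eq w (z :: w') & path E z w'.
Proof.
move=> symE uw sw /splitPr zw; case: zw uw sw => w1 w2.
case: (lastP w1) => [|{}w1 u]; first by exists w2.
case: w2 => [|v w2] uw sw uniq_nbr.
  exists (rev (rcons w1 u)); last first.
    by rewrite -sorted_flip // rev_cat rev_cons /= in sw.
  by rewrite perm_catC /= perm_cons perm_sym perm_rev.
move: sw; rewrite sorted_glue /= => /and3P[].
rewrite -!cats1 -catA sorted_glue /= => /and3P[_ uz _] zv _.
suff uv : u = v.
  move: uw; rewrite uv cat_uniq => /and3P[_ /hasPn/(_ v)].
  by rewrite /= mem_rcons !inE !eqxx orbT => /(_ isT).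
have zu : E z u by rewrite symE.
by apply: uniq_nbr => //; rewrite mem_cat ?mem_rcons !inE eqxx ?orbT.
Qed.


Ltac perm4 p q r s :=
  let P := fresh "P" in apply/permP; intro P; rewrite /=;
  by case: (P p); case: (P q); case: (P r); case: (P s).

(* The two rails a -- a' and b -- b' are replaced by the longer rails
   a -- p -- r -- a' and b -- q -- s -- b' with the rungs p -- q and r -- s.
   By the hypothesis on neighbours, a corner that uses neither its rail nor its
   rung is an end of w. *)
Lemma extend_rails B a b a' b' p q r s w :
  symmetric B ->
  B a p -> B p r -> B r a' -> B b q -> B q s -> B s b' -> B p q -> B r s ->
  uniq [:: p; q; r; s] -> has (mem w) [:: a; b; a'; b'] ->
  (forall x y, (x, y) \in [:: (a, b); (b, a); (a', b'); (b', a')] ->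
     {in w &, forall u v, B x u -> B x v -> u != y -> v != y -> u = v}) ->
  uniq w -> ~~ has (mem w) [:: p; q; r; s] ->
  sorted (relU (relU B (link b b')) (link a a')) w ->
  exists2 w', perm_eq w' ([:: p; q; r; s] ++ w) & sorted B w'.
Proof.
move=> symB ap pr ra' bq qs sb' pq rs upqrs corner nbr uw freshw sw.
have sym_link x y : symmetric (link x y) 
  by move=> u v; rewrite /link /= orbC (andbC (u == x)) (andbC (u == y)).
have symU E1 E2 : symmetric E1 -> symmetric E2 -> symmetric (relU E1 E2).
  by move=> s1 s2 u v; rewrite /= s1 s2.
have flip x y : B x y -> B y x by rewrite symB.
have insert w0 w1 x y w2 t : perm_eq w0 (w1 ++ [:: x, y & w2]) ->
    perm_eq (w1 ++ x :: t ++ y :: w2) (t ++ w0).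
  move=> /(perm_cat (perm_refl t)) tw; rewrite perm_sym (perm_trans tw) //.
  by rewrite perm_catCA perm_cat2l -cat1s -[x :: t ++ _]cat1s perm_catCA.
have insert4 w1 x y w2 t : perm_eq t [:: p; q; r; s] ->
    perm_eq w (w1 ++ [:: x, y & w2]) ->
    perm_eq (w1 ++ x :: t ++ y :: w2) ([:: p; q; r; s] ++ w).
  move=> tP wP; rewrite (perm_trans (insert _ w1 x y w2 t wP)) //.
  exact: perm_cat.
(* First case: [w] uses the rail [a] -- [a']. Then [p] and [r] are inserted there. *)
case: (sorted_split_link (symU _ _ symB (sym_link _ _)) uw sw); last first.
  case=> w1 [w2 [perm_w s1 s2]].
  have perm_W : perm_eq (w1 ++ a :: [:: p; r] ++ a' :: w2) ([:: p; r] ++ w).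
    exact: insert.
  have uW : uniq (w1 ++ a :: [:: p; r] ++ a' :: w2).
    rewrite (perm_uniq perm_W) /=; move: upqrs freshw.
    rewrite /= !inE !negb_or uw => /and4P[/and3P[_ -> _] _ _ _].
    by case/and5P=> -> _ -> _ _.
  have sW : sorted (relU B (link b b')) (w1 ++ a :: [:: p; r] ++ a' :: w2).
    by rewrite sorted_glue s1 /= ap pr ra' s2.
  case: (sorted_split_link symB uW sW) => [|[w3 [w4 [perm_W' s3 s4]]]].
    rewrite sorted_glue /= => /and5P[s3 _ _ _ s4].
    exists (w1 ++ a :: [:: p; q; s; r] ++ a' :: w2).
      by refine (insert4 _ _ _ _ _ _ perm_w); perm4 p q r s.
    by rewrite sorted_glue s3 /= ap pq qs flip // ra' s4.
  exists (w3 ++ b :: [:: q; s] ++ b' :: w4).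
    apply: (perm_trans (insert _ _ _ _ _ [:: q; s] perm_W')).
    apply: (perm_trans (perm_cat (perm_refl [:: q; s]) perm_W)).
    perm4 p q r s.
  by rewrite sorted_glue s3 /= bq qs sb' s4.
move=> {}sw; case: (sorted_split_link symB uw sw); last first.
  case=> w1 [w2 [perm_w s1 s2]].
  exists (w1 ++ b :: [:: q; p; r; s] ++ b' :: w2).
    by refine (insert4 _ _ _ _ _ _ perm_w); perm4 p q r s.
  by rewrite sorted_glue s1 /= bq (flip _ _ pq) pr rs sb' s2.
move=> {}sw.
(* Neither rail is used. The rungs [a] -- [b] and [a'] -- [b'] are split off in turn; a rung that is
   used is replaced by a detour through all four new vertices. *)
pose without (E : rel T) x y : rel T := [rel u v | E u v && ~~ link x y u v].
have sym_without E x y : symmetric E -> symmetric (without E x y).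
  by move=> symE u v; rewrite /without /= -!(sym_link x y u v) symE.
have sub_without E x y : subrel E (relU (without E x y) (link x y)).
  by move=> u v uv; rewrite /without /= uv /= orNb.
have sub_B E x y u v : without E x y u v -> E u v by case/andP.
set B1 := without B a b; set B2 := without B1 a' b'.
have symB2 : symmetric B2 by do 2!apply: (sym_without).
have sw1 := sub_sorted (sub_without B a b) sw.
case: (sorted_split_link (sym_without _ _ _ symB) uw sw1); last first.
  case=> w1 [w2 [perm_w s1 s2]].
  exists (w1 ++ a :: [:: p; r; s; q] ++ b :: w2).
    by refine (insert4 _ _ _ _ _ _ perm_w); perm4 p q r s.
  rewrite sorted_glue (sub_sorted (@sub_B B a b) s1) /= ap pr rs (flip _ _ qs).
  by rewrite (flip _ _ bq) (sub_path (@sub_B B a b) s2).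
move=> {}sw1; have sw2 := sub_sorted (sub_without B1 a' b') sw1.
have sub_B1 u v : without B1 a' b' u v -> B u v by do 2!move/sub_B.
case: (sorted_split_link (sym_without _ _ _ (sym_without _ _ _ symB)) uw sw2); last first.
  case=> w1 [w2 [perm_w s1 s2]].
  exists (w1 ++ a' :: [:: r; p; q; s] ++ b' :: w2).
    by refine (insert4 _ _ _ _ _ _ perm_w); perm4 p q r s.
  rewrite sorted_glue (sub_sorted sub_B1 s1) /= (flip _ _ ra') (flip _ _ pr) pq qs.
  by rewrite sb' (sub_path sub_B1 s2).
move=> {}sw2.
(* Neither rung is used. A corner on [w] now has at most one remaining neighbour there, so it is an
   end, and the new vertices are put in front of it. *)
have [z [zw zC]] : exists z, z \in w /\ z \in [:: a; b; a'; b'].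
  by have /hasP[z zC zw] := corner; exists z.
have link_neq x y u : ~~ link x y x u -> u != y.
  by rewrite /link /= eqxx /=; apply: contraNneq => ->; rewrite eqxx.
have link_neq' x y u : ~~ link x y y u -> u != x.
  by rewrite /link /= eqxx /= orbC; apply: contraNneq => ->; rewrite eqxx.
have end_z : {in w &, forall u v, B2 z u -> B2 z v -> u = v}.
  move=> u v uw' vw' /andP[/andP[zu Nzu] N'zu] /andP[/andP[zv Nzv] N'zv].
  move: zC; rewrite !inE => /or4P[]/eqP ?; subst z.
  - by apply: (nbr a b); rewrite ?inE ?eqxx ?orbT //;
      [exact: link_neq Nzu | exact: link_neq Nzv].
  - by apply: (nbr b a); rewrite ?inE ?eqxx ?orbT //;
      [exact: link_neq' Nzu | exact: link_neq' Nzv].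
  - by apply: (nbr a' b'); rewrite ?inE ?eqxx ?orbT //;
      [exact: link_neq N'zu | exact: link_neq N'zv].
  - by apply: (nbr b' a'); rewrite ?inE ?eqxx ?orbT //;
      [exact: link_neq' N'zu | exact: link_neq' N'zv].
have [w' perm_w sw'] := path_end symB2 uw sw2 zw end_z.
have {}sw' : path B z w' := sub_path sub_B1 sw'.
suff [t perm_t st] : exists2 t, perm_eq t [:: p; q; r; s] & sorted B (rcons t z).
  exists (t ++ z :: w'); last by rewrite sorted_glue st.
  by apply: perm_cat => //; rewrite perm_sym.
move: zC; rewrite !inE => /or4P[]/eqP->.
- exists [:: q; s; r; p]; first perm4 p q r s.
  by rewrite /= qs (flip _ _ rs) (flip _ _ pr) (flip _ _ ap).
- exists [:: p; r; s; q]; first perm4 p q r s.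
  by rewrite /= pr rs (flip _ _ qs) (flip _ _ bq).
- exists [:: s; q; p; r]; first perm4 p q r s.
  by rewrite /= (flip _ _ qs) (flip _ _ pq) pr ra'.
- exists [:: r; p; q; s]; first perm4 p q r s.
  by rewrite /= (flip _ _ pr) pq qs sb'.
Qed.

End Insertion.

(** * The ladder and its short cycles *)

(** The value depends only on [n] modulo 4, so that inserting two columns preserves the closing edge
    at [tip n]. *)
Definition tip n := 2 + ((n %% 4 == 1) || (n %% 4 == 2)).

Definition forward n u v := [|| v == u.+2, (u %% 2 == 0) && (v == u.+1),
  (u < 2) && (v == n.-1) | (u == tip n) && (v == n - 2)].

Definition ladder n : rel nat :=
  [rel u v | [&& u < n, v < n & forward n u v || forward n v u]].

Lemma ladder_sym n : symmetric (ladder n).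
Proof. by move=> u v; rewrite /ladder /= orbC andbCA. Qed.

Lemma ladder_irr n : 10 < n -> irreflexive (ladder n).
Proof. by move=> ngt u; rewrite /ladder /forward /tip /=; lia. Qed.

Lemma ladder_triangle n a b c : 10 < n -> triangle (ladder n) a b c ->
  a \in [:: 0; 1; n.-1].
Proof.
move=> ngt; rewrite /triangle /ladder /forward /tip /= !inE.
lia.
Qed.

(** These are the outcomes of [no_matching3_structure] for red edges in the ladder; two triangles do
    not occur, since the ladder has only one. *)
Definition obstruction n (vs S : seq nat) :=
  [\/ size vs <= 2 /\ S = [::],
      size vs <= 1 /\ exists a b c, S = [:: a; b; c] /\ triangle (ladder n) a b c
    | vs = [::] /\ exists a b c d e,
        S = [:: a; b; c; d; e] /\ cycle5 (ladder n) a b c d e].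

Definition avoiding n (S : seq nat) : rel nat :=
  [rel x y | ladder n x y && ~~ ((x \in S) && (y \in S))].

(* vs are vertices to avoid; the edges with both ends in S are to be avoided. *)
Definition robust n := forall vs S, obstruction n vs S ->
  exists p, [/\ uniq p, size p = n - 2, all (fun x => (x < n) && (x \notin vs)) p
    & sorted (avoiding n S) p].

(** Covers the closing edges, directed from the low to the high end. Both possible values of [tip n]
    are allowed, which keeps [tip] out of the arithmetic. *)
Definition far n u v := (u < 2 /\ v = n - 1) \/ (1 < u < 4 /\ v = n - 2).

(* The parity of u + u/2 is a proper 2-colouring of the ladder without the
   closing edges. *)
Lemma ladder_local n u v : 20 < n -> ladder n u v ->
  [\/ [/\ u <= v + 2, v <= u + 2 & (u + u %/ 2 + v + v %/ 2) %% 2 = 1],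
      far n u v | far n v u].
Proof.
move=> ngt; rewrite /ladder /forward /tip /far /= => /and3P[un vn].
case/orP=> /or4P[/eqP e|/andP[/eqP e0 /eqP e]|/andP[e0 /eqP e]|/andP[/eqP e0 /eqP e]].
- by constructor 1; split; lia.
- by constructor 1; split; lia.
- by constructor 2; lia.
- by constructor 2; lia.
- by constructor 1; split; lia.
- by constructor 1; split; lia.
- by constructor 3; lia.
- by constructor 3; lia.
Qed.

(** By the 2-colouring in [ladder_local], a 5-cycle uses a closing edge. With just one, four steps
    of at most 2 would have to bridge a gap of at least 16. With more, both edges at a vertex [a]
    between 6 and 17 are still local, and the closing edges among the other three force two vertices
    of the cycle to coincide. *)
Lemma ladder_cycle5 n a b c d e : 20 < n -> cycle5 (ladder n) a b c d e ->
  (a < 6) || (18 <= a).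
Proof.
move=> ngt /andP[uC /and5P[ab bc cd de ea]]; apply/negPn/negP => mid.
have {mid} [mid1 mid2] : 5 < a /\ a < 18 by lia.
have {uC} [bNe cNe bNd] : [/\ b != e, c != e & b != d].
  by move: uC; rewrite /= !inE; split; lia.
have [[ab1 ab2 ab3]|far_ab|far_ab] := ladder_local ngt ab;
  [|rewrite /far in far_ab; clear -far_ab ngt mid1 mid2; lia..].
have [[ea1 ea2 ea3]|far_ea|far_ea] := ladder_local ngt ea;
  [|rewrite /far in far_ea; clear -far_ea ngt mid1 mid2; lia..].
have := ladder_local ngt bc; have := ladder_local ngt cd; have := ladder_local ngt de.
rewrite /far => -[[de1 de2 de3]|de1|de1] [[cd1 cd2 cd3]|cd1|cd1]
  [[bc1 bc2 bc3]|bc1|bc1]; clear ab bc cd de ea; lia.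
Qed.

Lemma cycle5_rot (T : eqType) (R : rel T) a b c d e :
  cycle5 R a b c d e -> cycle5 R b c d e a.
Proof.
rewrite /cycle5 -(rot_uniq 1) /rot /= => /andP[-> /and5P[-> -> -> -> ->]].
by [].
Qed.

Lemma triangle_rot (T : eqType) (R : rel T) a b c :
  triangle R a b c -> triangle R b c a.
Proof. by case/and3P=> ab bc ca; apply/and3P. Qed.

(** * Contracting and inserting two columns *)

Definition raise c v := if v < c then v else v + 4.
Definition lower c v := if v < c then v else v - 4.

Lemma tipD4 n : tip (n + 4) = tip n.
Proof. by rewrite /tip modnDr. Qed.

Lemma tip_bounds n : 1 < tip n < 4.
Proof. by rewrite /tip; case: (_ || _). Qed.

Lemma ladder_rail n u : u.+2 < n -> ladder n u u.+2.
Proof. by move=> un; rewrite /ladder /forward /= un (ltn_trans _ un) //= eqxx. Qed.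

Lemma ladder_rung n u : u %% 2 = 0 -> u.+1 < n -> ladder n u u.+1.
Proof.
by move=> u2 un; rewrite /ladder /forward /= u2 un (ltn_trans _ un) //= !eqxx orbT.
Qed.

Lemma ladder_hub n u : u < 2 -> 10 < n -> ladder n u n.-1.
Proof.
move=> u2 ngt; rewrite /ladder /forward /= u2 eqxx /= !orbT !andbT.
by apply/andP; split; lia.
Qed.

Lemma ladder_tip n : 10 < n -> ladder n (tip n) (n - 2).
Proof.
move=> ngt; have := tip_bounds n; rewrite /ladder /forward /= !eqxx /= !orbT !andbT.
by move=> tb; apply/andP; split; lia.
Qed.

Lemma ladder_elim n (P : nat -> nat -> Prop) :
  (forall x y, P x y -> P y x) ->
  (forall u, u.+2 < n -> P u u.+2) ->
  (forall u, u %% 2 = 0 -> u.+1 < n -> P u u.+1) ->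
  (forall u, u < 2 -> P u n.-1) -> P (tip n) (n - 2) ->
  forall x y, ladder n x y -> P x y.
Proof.
move=> symP rail rung hub tipP x y /and3P[xn yn].
suff fw u v : u < n -> v < n -> forward n u v -> P u v.
  by case/orP => [/fw|/fw vu]; [exact|apply: symP; apply: vu].
move=> un vn /or4P[/eqP e|/andP[/eqP u2 /eqP e]|/andP[u2 /eqP->]|/andP[/eqP-> /eqP->]] //.
- by rewrite e in vn *; apply: rail.
- by rewrite e in vn *; apply: rung.
exact: hub.
Qed.

(** Only the two rails across the gap are stretched; they become the two links. As [c] is even,
    rungs stay rungs, and the bounds on [c] keep the low ends of the closing edges below the gap and
    the high ends above it. *)
Lemma raise_ladder n c x y : 16 < n -> 5 < c < 15 -> c %% 2 = 0 -> ladder n x y ->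
  relU (relU (ladder (n + 4)) (link (c - 1) (c + 5))) (link (c - 2) (c + 4))
    (raise c x) (raise c y).
Proof.
move=> ngt cb ce; have n4 : 10 < n + 4 by lia.
have nE : (n + 4).-1 = n.-1 + 4 /\ n + 4 - 2 = n - 2 + 4 by lia.
have tb := tip_bounds n; move: x y.
apply: ladder_elim => [x y|u un|u u2 un|u u2|]; rewrite /raise.
- rewrite /= ladder_sym /link /= => /orP[/orP[->//|]|];
  rewrite orbC ![_ && (_ == c - _)]andbC => ->.
  + by rewrite orbT.
  + by rewrite orbT.
- case: (ltnP u.+2 c) => uc.
    by have -> : u < c; [lia | rewrite /= ladder_rail //; lia].
  case: (ltnP u c) => uc'; last by rewrite /= !addSn ladder_rail // -!addSn; lia.
  by rewrite /= /link /=; lia.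
- have -> : (u.+1 < c) = (u < c) by lia.
  case: (ltnP u c) => uc; first by rewrite /= ladder_rung //; lia.
  by rewrite /= addSn ladder_rung //; lia.
- have -> : u < c by lia.
  have -> : (n.-1 < c) = false by lia.
  by rewrite /= -(proj1 nE) ladder_hub.
have -> : tip n < c by lia.
have -> : (n - 2 < c) = false by lia.
by rewrite /= -(proj2 nE) -tipD4 ladder_tip.
Qed.

Lemma lower_ladder n c x y : 16 < n -> 5 < c < 15 -> c %% 2 = 0 ->
  ladder (n + 4) x y -> ~~ (c <= x < c + 4) -> ~~ (c <= y < c + 4) ->
  ladder n (lower c x) (lower c y).
Proof.
move=> ngt cb ce; have n10 : 10 < n by lia.
have tb := tip_bounds n; move: x y.
apply: ladder_elim => [x y xy oy ox|u un|u u2 un|u u2|]; rewrite /lower.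
- by rewrite ladder_sym; apply: xy.
- move=> ou ou'; case: (ltnP u.+2 c) => uc.
    by have -> : u < c; [lia | apply: ladder_rail; lia].
  have -> : (u < c) = false by lia.
  by have -> : u.+2 - 4 = (u - 4).+2; [lia | apply: ladder_rail; lia].
- move=> ou ou'; have -> : (u.+1 < c) = (u < c) by lia.
  case: (ltnP u c) => uc; first by apply: ladder_rung; lia.
  by have -> : u.+1 - 4 = (u - 4).+1; [lia | apply: ladder_rung; lia].
- move=> _ _; have -> : u < c by lia.
  have -> : ((n + 4).-1 < c) = false by lia.
  by have -> : (n + 4).-1 - 4 = n.-1; [lia | apply: ladder_hub].
move=> _ _; rewrite tipD4; have -> : tip n < c by lia.
have -> : (n + 4 - 2 < c) = false by lia.
by have -> : n + 4 - 2 - 4 = n - 2; [lia | apply: ladder_tip].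
Qed.

(** The three windows starting at 6, 10 and 14 are disjoint and fill the range from 6 to 17, which
    [S] avoids. The at most two vertices of [vs] leave one window free. *)
Lemma obstruction_window n vs S : 20 < n -> obstruction n vs S ->
  exists c, [/\ 5 < c < 15, c %% 2 = 0 & all (fun x => ~~ (c <= x < c + 4)) (vs ++ S)].
Proof.
move=> ngt obs.
have [vs2 SP] : size vs <= 2 /\ all (fun x => (x < 6) || (18 <= x)) S.
  case: obs => [[vs2 ->]|[vs1 [a [b [c [-> abc]]]]]|[-> [a [b [c [d [e [-> C5]]]]]]]] //.
    split; first exact: leqW.
    have low x y z : triangle (ladder n) x y z -> (x < 6) || (18 <= x).
      have ngt10 : 10 < n by lia.
      by move/(ladder_triangle ngt10);
        rewrite !inE; lia.
    have bca := triangle_rot abc; have cab := triangle_rot bca.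
    by rewrite /= (low _ _ _ abc) (low _ _ _ bca) (low _ _ _ cab).
  have C5b := cycle5_rot C5; have C5c := cycle5_rot C5b.
  have C5d := cycle5_rot C5c; have C5e := cycle5_rot C5d.
  by split=> //=; rewrite !(ladder_cycle5 ngt C5, ladder_cycle5 ngt C5b,
    ladder_cycle5 ngt C5c, ladder_cycle5 ngt C5d, ladder_cycle5 ngt C5e).
suff [c cP vsc] : exists2 c, c \in [:: 6; 10; 14] &
    all (fun x => ~~ (c <= x < c + 4)) vs.
  have cb : 5 < c < 15 /\ c %% 2 = 0 by move: cP; rewrite !inE; lia.
  exists c; case: cb => cb ce; split=> //.
  by rewrite all_cat vsc /=; apply: sub_all SP => x; lia.
have pick (P : pred nat) : P 6 || P 10 || P 14 -> exists2 c, c \in [:: 6; 10; 14] & P c.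
  by case/orP=> [/orP[]|] Pc; [exists 6 | exists 10 | exists 14].
apply: (pick (fun c => all (fun x => ~~ (c <= x < c + 4)) vs)).
by case: vs vs2 {obs} => [|u [|v []]] //= _; lia.
Qed.

Lemma raise_inj c : injective (raise c).
Proof. by move=> x y; rewrite /raise; case: (ltnP x c); case: (ltnP y c); lia. Qed.

Lemma raiseK c x : lower c (raise c x) = x.
Proof. by rewrite /raise /lower; case: (ltnP x c) => xc; case: ltnP; lia. Qed.

Lemma lower_obstruction n c vs S : 16 < n -> 5 < c < 15 -> c %% 2 = 0 ->
  all (fun x => ~~ (c <= x < c + 4)) S ->
  obstruction (n + 4) vs S -> obstruction n (map (lower c) vs) (map (lower c) S).
Proof.
move=> ngt cb ce outS.
case=> [[vs2 eS]|[vs1 [x [y [z [eS xyz]]]]]|[evs [v [w [x [y [z [eS C5]]]]]]]].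
- by constructor 1; rewrite size_map eS.
- constructor 2; rewrite size_map; split=> //; rewrite eS.
  exists (lower c x), (lower c y), (lower c z); split=> //.
  move: outS; rewrite eS /= => /and4P[ox oy oz _].
  by case/and3P: xyz => xy yz zx; apply/and3P; split; apply: lower_ladder.
constructor 3; split; first by rewrite evs.
rewrite eS; exists (lower c v), (lower c w), (lower c x), (lower c y), (lower c z).
split=> //; case/andP: C5 => uC /and5P[vw wx xy yz zv].
move: outS; rewrite eS => outC.
have /and5P[ov ow ox oy /andP[oz _]] := outC.
apply/andP; split; last by apply/and5P; split; apply: lower_ladder.
rewrite -[[:: _; _; _; _; _]]/(map (lower c) [:: v; w; x; y; z]) map_inj_in_uniq //.
move=> s t /(allP outC) /= os /(allP outC) /= ot; rewrite /lower.
by clear -os ot; case: (ltnP s c); case: (ltnP t c); lia.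
Qed.

Lemma avoiding_sym n S : symmetric (avoiding n S).
Proof. by move=> x y; rewrite /avoiding /= ladder_sym andbC [(y \in S) && _]andbC andbC. Qed.

(** The last alternative arises only for [n = 21] and [x = 19]. *)
Lemma ladder_interior n x u : 20 < n -> 3 < x < 20 -> ladder n x u ->
  [|| (u == x.+2) && (u < n), u.+2 == x, (x %% 2 == 0) && (u == x.+1),
      (x %% 2 == 1) && (u.+1 == x) | (x == n - 2) && (u == tip n)].
Proof.
move=> ngt xb; rewrite /ladder /forward /=; have := tip_bounds n.
by move: (tip n) => t tb; lia.
Qed.

(** This is the hypothesis on neighbours in [extend_rails]. Apart from its rung partner [y] and a
    vertex in the window, a corner has at most one neighbour. *)
Lemma dead_end n c x y u v : 20 < n -> 5 < c < 15 -> c %% 2 = 0 ->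
  (x, y) \in [:: (c - 2, c - 1); (c - 1, c - 2); (c + 4, c + 5); (c + 5, c + 4)] ->
  ladder n x u -> ladder n x v -> u != y -> v != y ->
  ~~ (c <= u < c + 4) -> ~~ (c <= v < c + 4) -> u = v.
Proof.
move=> ngt cb ce xy; have xb : 3 < x < 20.
  by move: xy; rewrite !inE => /or4P[]/eqP[-> _]; lia.
move=> /(ladder_interior ngt xb) xu /(ladder_interior ngt xb) xv uy vy um vm.
have tb := tip_bounds n; move: (tip n) tb xu xv => t tb.
by move: xy uy vy; rewrite !inE => /or4P[]/eqP[-> ->] uy vy xu xv; lia.
Qed.

Lemma robust_step n : 16 < n -> robust n -> robust (n + 4).
Proof.
move=> ngt rob vs S obs; have n4 : 20 < n + 4 by lia.
have [c [cb ce]] := obstruction_window n4 obs.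
rewrite all_cat => /andP[/allP outvs outS].
have [p [up sp /allP ap sorted_p]] := rob _ _ (lower_obstruction ngt cb ce outS obs).
move/allP: outS => outS.
pose w := map (raise c) p.
have wP z : z \in w -> [/\ ~~ (c <= z < c + 4), z < n + 4 & z \notin vs].
  case/mapP=> x /ap /andP[xn xvs] ->; split.
  - by rewrite /raise; case: (ltnP x c); lia.
  - by rewrite /raise; case: (ltnP x c); lia.
  - by apply: contra xvs => /(map_f (lower c)); rewrite raiseK.
have midS z : c <= z < c + 4 -> z \notin S.
  by move=> zm; apply/negP => /outS; rewrite /= zm.
(* [S] has no vertex in the window, so every ladder edge that meets the window may be used. *)
have edge x y : ladder (n + 4) x y -> (c <= x < c + 4) || (c <= y < c + 4) ->
    avoiding (n + 4) S x y.
  by move=> xy /orP[]/midS/negPf zS; rewrite /avoiding /= xy zS ?andbF.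
have sorted_w : sorted (relU (relU (avoiding (n + 4) S) (link (c - 1) (c + 5)))
    (link (c - 2) (c + 4))) w.
  rewrite sorted_map; apply: sub_sorted sorted_p => x y /andP[xy xyS].
  have := raise_ladder ngt cb ce xy; rewrite /= /avoiding /=.
  have -> : ~~ ((raise c x \in S) && (raise c y \in S)).
    by apply: contra xyS => /andP[/(map_f (lower c)) + /(map_f (lower c))];
      rewrite !raiseK => -> ->.
  by rewrite andbT.
have rail u : c <= u + 2 -> u < c + 4 -> avoiding (n + 4) S u u.+2.
  by move=> cu uc; apply: edge; [apply: ladder_rail|]; lia.
have rung u : u %% 2 = 0 -> c <= u < c + 4 -> avoiding (n + 4) S u u.+1.
  by move=> u2 uc; apply: edge; [apply: ladder_rung|]; lia.
have [w' perm_w' sorted_w'] : exists2 w', perm_eq w' ([:: c; c.+1; c.+2; c.+3] ++ w)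
    & sorted (avoiding (n + 4) S) w'.
  apply: (@extend_rails _ _ (c - 2) (c - 1) (c + 4) (c + 5)) => //.
  - exact: avoiding_sym.
  - by have {2}-> : c = (c - 2).+2; [lia | apply: rail; lia].
  - by apply: rail; lia.
  - by have -> : c + 4 = c.+2.+2; [lia | apply: rail; lia].
  - by have -> : c.+1 = (c - 1).+2; [lia | apply: rail; lia].
  - by apply: rail; lia.
  - by have -> : c + 5 = c.+3.+2; [lia | apply: rail; lia].
  - by apply: rung; lia.
  - by apply: rung; lia.
  - by rewrite /= !inE; clear; lia.
  (* Without a corner on [w], the path [p] would miss the four vertices that [raise] maps to the
     corners, and so have at most [n - 4] vertices. *)
  - apply: contraT => /hasPn nocorner.
    have corner z : raise c z \in [:: c - 2; c - 1; c + 4; c + 5] -> z \notin p.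
      by move/nocorner; apply: contra => zp; apply: map_f.
    suff: size ([:: c - 2; c - 1; c; c.+1] ++ p) <= size (iota 0 n).
      by rewrite size_cat size_iota sp /=; lia.
    apply: uniq_leq_size => [|z].
      rewrite cat_uniq up andbT; apply/andP; split.
        by rewrite /= !inE; clear -cb; lia.
      apply/hasPn => z zp; apply: contraL zp; rewrite !inE => zc; apply: corner.
      by move: zc; rewrite !inE /raise; clear -cb; case: (ltnP z c); lia.
    rewrite mem_cat mem_iota => /orP[|/ap/andP[]] //.
    by rewrite !inE; clear -cb ngt; lia.
  - move=> x y xy u v /wP[um _ _] /wP[vm _ _] /andP[xu _] /andP[xv _] uy vy.
    exact: (dead_end n4 cb ce xy).
  - by rewrite map_inj_uniq //; apply: raise_inj.
  - apply/hasPn => z; rewrite !inE => zm; apply/negP => /wP[zo _ _].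
    by clear -zm zo; lia.
exists w'; split=> //.
- rewrite (perm_uniq perm_w') cat_uniq map_inj_uniq ?up ?andbT; last exact: raise_inj.
  apply/andP; split; first by rewrite /= !inE; clear; lia.
  by apply/hasPn => z /wP[zo _ _]; rewrite !inE; clear -zo; lia.
- by rewrite (perm_size perm_w') size_cat size_map sp /=; lia.
rewrite (perm_all _ perm_w') all_cat; apply/andP; split; last first.
  by apply/allP => z /wP[_ -> ->].
apply/allP => z; rewrite !inE => zm; apply/andP; split; first by clear -zm cb ngt; lia.
by apply/negP => /outvs; clear -zm; lia.
Qed.

(** * Computation for small ladders *)

(* The paths that this depth-first search returns are verified by its callers,
   so nothing is proved about it. *)
Fixpoint extend (nb : seq (seq nat)) (good : pred (seq nat)) k (p : seq nat) (v : nat)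
  : option (seq nat) :=
  if k is k'.+1 then
    (fix try l := if l is w :: l' then
       if w \in p then try l' else
       if extend nb good k' (v :: p) w is Some q then Some q else try l'
     else None) (nth [::] nb v)
  else if good (v :: p) then Some (v :: p) else None.

Definition neighbours n (S : seq nat) v :=
  [seq w <- rev (iota 0 n) | avoiding n S v w].

Definition table n (vs S : seq nat) := [seq if v \in vs then [::] else
  [seq w <- neighbours n S v | w \notin vs] | v <- iota 0 n].

(** A Hamiltonian cycle of the ladder without [u] settles all pairs containing [u] at once: deleting
    a second vertex leaves a path. *)
Definition cycle_check n u :=
  let nb := table n [:: u] [::] in
  let s := if u is 0 then 1 else 0 in
  if extend nb (fun q => head 0 q \in nth [::] nb s) (n - 2) [::] s is Some q
  then [&& uniq q, size q == n - 1, all (fun x => (x < n) && (x != u)) q & cycle (ladder n) q]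
  else false.


(* The search starts at the vertices of degree one that the removal of the edges
   on S creates. *)
Definition path_check n (vs S : seq nat) :=
  let nb := table n vs S in
  has (fun s => if extend nb predT (n - 3) [::] s is Some q then
    [&& uniq q, size q == n - 2, all (fun x => (x < n) && (x \notin vs)) q
      & sorted (avoiding n S) q] else false) [seq s <- iota 0 n | size (nth [::] nb s) == 1].

Definition triangle_check n :=
  all (fun v => path_check n [:: v] [:: 0; 1; n.-1]) (iota 0 n).

(* With ==> in place of the conditional, vm_compute would evaluate path_check
   for all walks. *)
Definition cycle5_check n :=
  let nb := table n [::] [::] in
  all (fun a => all (fun b => all (fun c => all (fun d => all (fun e =>
    if cycle5 (ladder n) a b c d e then path_check n [::] [:: a; b; c; d; e] else true)
  (nth [::] nb d)) (nth [::] nb c)) (nth [::] nb b)) (nth [::] nb a)) (iota 0 n).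


Lemma cycle_check_path n u v : 10 < n -> all (cycle_check n) (iota 0 n) ->
  exists p, [/\ uniq p, size p = n - 2,
    all (fun x => (x < n) && (x \notin [:: u; v])) p & sorted (ladder n) p].
Proof.
(* If [u] is not a vertex of the ladder, 0 is removed in its place. *)
move=> ngt /allP check; pose u' := if u < n then u else 0.
have u'n : u' < n by rewrite /u'; case: (ltnP u n) => //; lia.
have := check u'; rewrite mem_iota u'n /cycle_check => /(_ isT).
case: extend => // q /and4P[uq /eqP sq /allP aq cq].
(* The cycle is cut open at [v], or at an arbitrary vertex if [v] is not on it. *)
have [z zq zv] : exists2 z, z \in q & (v \in q) ==> (z == v).
  have [vq|vq] := boolP (v \in q); first by exists v; rewrite /= ?eqxx.
  by case: q sq {uq aq cq vq} => [|z q] /= sq; [lia | exists z; rewrite ?mem_head].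
have [i t rot_q] := rot_to zq.
have in_q x : x \in t -> x \in q by rewrite -(mem_rot i q) rot_q inE => ->; rewrite orbT.
have [zt ut] : z \notin t /\ uniq t by apply/andP; rewrite -cons_uniq -rot_q rot_uniq.
exists t; split=> //.
- by have := congr1 size rot_q; rewrite size_rot sq /=; lia.
- apply/allP => x xt; have /andP[xn xu'] := aq _ (in_q x xt).
  rewrite xn in_cons mem_seq1 negb_or /=; apply/andP; split.
    by move: xu' xn; rewrite /u'; case: ltnP => // un _ xn; lia.
  apply/negP => /eqP xv; case/negP: zt; move: zv.
  by rewrite -xv (in_q x xt) /= => /eqP ->.
move: cq; rewrite -(rot_cycle i) rot_q /= rcons_path => /andP[zt_path _].
exact: path_sorted zt_path.
Qed.

Lemma path_check_path n vs S : path_check n vs S ->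
  exists p, [/\ uniq p, size p = n - 2,
    all (fun x => (x < n) && (x \notin vs)) p & sorted (avoiding n S) p].
Proof. by case/hasP=> s _; case: extend => // q /and4P[? /eqP ? ? ?]; exists q. Qed.

Lemma mem_neighbours n v w : ladder n v w -> w \in nth [::] (table n [::] [::]) v.
Proof.
move=> vw; have /and3P[vn wn _] := vw.
rewrite (nth_map 0) ?size_iota // nth_iota //= !mem_filter /= /avoiding /= vw.
by rewrite mem_rev mem_iota.
Qed.

Lemma robust_check n : 10 < n -> all (cycle_check n) (iota 0 n) ->
  triangle_check n -> cycle5_check n -> robust n.
Proof.
move=> ngt cyc /allP tri /allP c5 vs S.
case=> [[vs2 ->]|[vs1 [a [b [c [-> abc]]]]]|[-> [a [b [c [d [e [-> C5]]]]]]]].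
- have [u [v sub]] : exists u v, {subset vs <= [:: u; v]}.
    case: vs vs2 => [|u [|v []]] // _; first by exists 0, 0.
      by exists u, u => x; rewrite !inE => ->.
    by exists u, v.
  have [p [up sp /allP ap pp]] := cycle_check_path u v ngt cyc.
  exists p; split=> //.
    by apply/allP => x /ap /andP[->]; apply: contra; apply: sub.
  by apply: sub_sorted pp => x y xy; rewrite /avoiding /= xy.
- have [v [vn sub]] : exists v, v < n /\ forall x, x < n -> x \in vs -> x = v.
    case: vs vs1 => [|v []] // _; first by exists 0; split => //; lia.
    have [vn|vn] := ltnP v n; first by exists v; split=> // x _; rewrite inE => /eqP.
    by exists 0; split=> [|x xn]; rewrite ?inE; lia.
  have := tri v; rewrite mem_iota vn => /(_ isT)/path_check_path.
  case=> p [up sp /allP ap pp]; exists p; split=> //.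
    apply/allP => x /ap /andP[xn xv]; rewrite xn; apply: contra xv => /(sub _ xn)->.
    exact: mem_head.
  apply: sub_sorted pp => x y /andP[xy xyT]; rewrite /avoiding /= xy /=.
  have bca := triangle_rot abc; have cab := triangle_rot bca.
  have /allP inT : all (mem [:: 0; 1; n.-1]) [:: a; b; c].
    apply/and4P; split=> //; [exact: ladder_triangle ngt abc
      | exact: ladder_triangle ngt bca | exact: ladder_triangle ngt cab].
  by apply: contra xyT => /andP[/inT /= -> /inT /= ->].
apply: path_check_path.
have := C5; case/andP=> _ /and5P[ab bc cd de ea].
have /and3P[an _ _] := ab.
have := c5 a; rewrite mem_iota an => /(_ isT).
move=> /allP/(_ b (mem_neighbours ab))/allP/(_ c (mem_neighbours bc)).
by move=> /allP/(_ d (mem_neighbours cd))/allP/(_ e (mem_neighbours de)); rewrite C5.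
Qed.

(** [robust_step] reaches only sizes from 21 on, so the ten sizes from 11 to 20 are all base
    cases. *)
Lemma robust_small n : 10 < n -> n < 21 -> robust n.
Proof.
move=> ngt nlt.
have nI : n \in iota 11 10 by rewrite mem_iota ngt nlt.
have /allP/(_ n nI)/and3P[cyc tri c5] : all (fun k =>
    [&& all (cycle_check k) (iota 0 k), triangle_check k & cycle5_check k]) (iota 11 10).
  by vm_compute.
exact: robust_check.
Qed.

Lemma robust_ge11 n : 10 < n -> robust n.
Proof.
have [k] := ubnP n; elim: k n => // k IHk n nk ngt.
have [nlt|n21] := ltnP n 21; first exact: robust_small.
have -> : n = n - 4 + 4 by lia.
by apply: robust_step; [lia | apply: IHk; lia].
Qed.

(** * Blue paths and the size Ramsey number *)

Lemma blue_path n (r : rel nat) : 10 < n -> symmetric r ->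
  no_matching3 [rel x y | ladder n x y && r x y] ->
  exists p, [/\ uniq p, size p = n - 2, all (fun x => x < n) p
    & sorted [rel x y | ladder n x y && ~~ r x y] p].
Proof.
move=> ngt symr; set R := [rel x y | _] => free.
have symR : symmetric R by move=> x y; rewrite /R /= ladder_sym symr.
have irrR : irreflexive R by move=> x; rewrite /R /= ladder_irr.
have subR : subrel R (ladder n) by move=> x y /andP[].
have sub_tri a b c : triangle R a b c -> triangle (ladder n) a b c.
  by case/and3P=> *; apply/and3P; split; apply: subR.
have main vs S : obstruction n vs S ->
    (forall x y, R x y -> [|| (x \in S) && (y \in S), x \in vs | y \in vs]) ->
    exists p, [/\ uniq p, size p = n - 2, all (fun x => x < n) p
      & sorted [rel x y | ladder n x y && ~~ r x y] p].
  move=> obs cover; have [p [up sp ap pp]] := robust_ge11 ngt obs.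
  exists p; split=> //; first by apply: sub_all ap => x /andP[].
  apply: sub_in_sorted ap pp => x y /andP[_ xvs] /andP[_ yvs] /andP[xy xyS].
  rewrite /= xy; apply/negP => rxy; have := cover x y; rewrite /R /= xy rxy.
  by rewrite (negPf xyS) (negPf xvs) (negPf yvs) => /(_ isT).
case: (no_matching3_structure symR irrR free 0).
- case=> u [v cuv]; apply: (main [:: u; v] [::]); first by constructor 1.
  by move=> x y /cuv.
- case=> a [b [c [v [/sub_tri abc cov]]]]; apply: (main [:: v] [:: a; b; c]).
    by constructor 2; split=> //; exists a, b, c.
  by move=> x y /cov; rewrite !mem_seq1.
(* The distinct vertices [a], [b], [c] exhaust 0, 1 and [n.-1], among which [p] lies as well. *)
- case=> a [b [c [p [q [s [abc pqs pN]]]]]]; case/negP: pN.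
  have inT x y z : triangle R x y z -> x \in [:: 0; 1; n.-1].
    by move/sub_tri; apply: ladder_triangle.
  have := inT _ _ _ pqs; have := inT _ _ _ abc.
  have bca := triangle_rot abc; have cab := triangle_rot bca.
  have := inT _ _ _ bca; have := inT _ _ _ cab; have /and3P[ab bc ca] := abc.
  have := edge_neq irrR ab; have := edge_neq irrR bc; have := edge_neq irrR ca.
  by rewrite !inE; clear; lia.
case=> a [b [c [d [e C5]]]]; apply: (main [::] [:: a; b; c; d; e]).
  constructor 3; split=> //; exists a, b, c, d, e; split=> //.
  case/andP: C5 => uC /and5P[*]; apply/andP; split=> //.
  by apply/and5P; split; apply: subR.
by move=> x y /(cycle5_within symR irrR free C5) ->.
Qed.

Definition ladder_graph_adj n : rel 'I_n := relpre val (ladder n).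

Lemma ladder_graph_adj_sym n : symmetric (@ladder_graph_adj n).
Proof. by move=> x y; apply: ladder_sym. Qed.

Lemma ladder_graph_adj_irrefl n : 10 < n -> irreflexive (@ladder_graph_adj n).
Proof. by move=> ngt x; apply: ladder_irr. Qed.

Definition ladder_graph n (ngt : 10 < n) : sgraph :=
  SGraph (@ladder_graph_adj_sym n) (ladder_graph_adj_irrefl ngt).

Lemma ladder_graph_connected n (ngt : 10 < n) : connected_graph (ladder_graph ngt).
Proof.
have n0 : 0 < n by lia.
split; first by rewrite card_ord.
have sym := sym_connect_sym (@ladder_graph_adj_sym n).
suff to0 (x : 'I_n) : connect (@ladder_graph_adj n) (Ordinal n0) x.
  by move=> x y; apply: connect_trans (to0 y); rewrite sym.
case: x => x; elim/ltn_ind: x => -[|[|x]] IHx xn.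
- by have -> : Ordinal xn = Ordinal n0 by apply: val_inj.
- by apply: connect1; apply: ladder_rung.
have xn' : x < n by lia.
apply: connect_trans (IHx x _ xn') _; first by lia.
by apply: connect1; apply: ladder_rail.
Qed.

Lemma ladder_graph_size n (ngt : 10 < n) : size_graph (ladder_graph ngt) <= n + n./2 + 1.
Proof.
(* There are [n - 2] rails, [n./2] rungs and 3 closing edges. Only an upper bound is claimed, so the
   listed edges need not be shown distinct. *)
pose arcs := [seq (u, u.+2) | u <- iota 0 (n - 2)] ++
  [seq (u.*2, u.*2.+1) | u <- iota 0 n./2] ++
  [:: (0, n.-1); (1, n.-1); (tip n, n - 2)].
have arcP x y : ladder n x y -> ((x, y) \in arcs) || ((y, x) \in arcs).
  move: x y; apply: ladder_elim => [x y|u un|u u2 un|u u2|].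
  - by rewrite orbC.
  - apply/orP; left; rewrite !mem_cat; apply/orP; left; apply/mapP.
    by exists u => //; rewrite mem_iota; lia.
  - apply/orP; left; rewrite !mem_cat; apply/orP; right; apply/orP; left.
    by apply/mapP; exists u./2; [rewrite mem_iota; lia | congr (_, _); lia].
  - rewrite !mem_cat; apply/orP; left; apply/orP; right; apply/orP; right.
    by case: u u2 => [|[]] // _; rewrite !inE eqxx ?orbT.
  - rewrite !mem_cat; apply/orP; left; apply/orP; right; apply/orP; right.
    by rewrite !inE eqxx !orbT.
have size_arcs : size arcs = n + n./2 + 1.
  by rewrite !size_cat !size_map !size_iota /=; lia.
rewrite -size_arcs /size_graph.
have n0 : 0 < n by lia.
pose o x : 'I_n := insubd (Ordinal n0) x.
have oK (x : 'I_n) : o x = x by rewrite /o valKd.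
have sub : edges (ladder_graph ngt) \subset [seq [set o p.1; o p.2] | p <- arcs].
  apply/subsetP => _ /imsetP[[x y] + ->]; rewrite inE /= => xy.
  case/orP: (arcP _ _ xy) => in_arcs; apply/mapP.
    by exists (val x, val y); rewrite //= !oK.
  by exists (val y, val x); rewrite //= !oK setUC.
apply: leq_trans (subset_leq_card sub) _.
by rewrite -(size_map (fun p => [set o p.1; o p.2])) card_size.
Qed.

Lemma no_matching3_of_copy_free (F : sgraph) :
  ~ has_copy F (matching_graph 3) -> no_matching3 (@adj F).
Proof.
move=> noM a b c d e f ab cd ef; apply/negP => u6; apply: noM.
(* [k] numbers the ends of the matching so that its [i]-th edge takes positions [2 i] and [2 i + 1]
   of [s]. *)
pose s := [:: a; b; c; d; e; f]; pose k (z : 'I_3 * bool) : nat := z.1 * 2 + z.2.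
have k6 z : k z < 6 by case: z => -[i i3] [] /=; rewrite /k /=; lia.
exists (fun z => nth a s (k z)).
  move=> [i x] [j y] /eqP; rewrite nth_uniq ?k6 // => /eqP; rewrite /k /=.
  move=> kE; have ij : i = j by apply: val_inj => /=; case: x y kE => -[]; lia.
  by move: kE; rewrite ij => /addnI; case: x y => -[].
move=> [[i i3] x] [[j j3] y]; rewrite /= /matching_adj /= => /andP[/eqP[e0] xy].
subst j; rewrite /k /=; case: i i3 j3 => [|[|[|]]] // _ _.
- by case: x y xy => -[] //= _; rewrite // adj_sym.
- by case: x y xy => -[] //= _; rewrite // adj_sym.
- by case: x y xy => -[] //= _; rewrite // adj_sym.
Qed.

Lemma path_copy (F : sgraph) (x0 : F) (s : seq F) :
  uniq s -> sorted (@adj F) s -> has_copy F (path_graph (size s)).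
Proof.
move=> us ss; exists (fun i : 'I_(size s) => nth x0 s i).
  by move=> i j /eqP; rewrite nth_uniq // => /eqP; apply: val_inj.
have next i : i.+1 < size s -> adj (nth x0 s i) (nth x0 s i.+1).
  exact: (sortedP x0 ss).
move=> i j /orP[]/eqP ij; last rewrite adj_sym;
  by rewrite -ij next // ij.
Qed.

Lemma ladder_graph_arrows n (ngt : 10 < n) :
  arrows (ladder_graph ngt) (matching_graph 3) (path_graph (n - 2)).
Proof.
move=> c; have [|no_red] := classic (has_copy (color_class c true) (matching_graph 3)).
  by left.
right; have n0 : 0 < n by lia.
(* Numbers from [n] on are sent to vertex 0; this is harmless, as ladder edges only join numbers
   below [n]. *)
pose o x : 'I_n := insubd (Ordinal n0) x.
have oK x : x < n -> val (o x) = x by move=> xn; rewrite val_insubd xn.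
pose r : rel nat := [rel x y | c [set o x; o y]].
have symr : symmetric r by move=> x y; rewrite /r /= setUC.
have red x y : ladder n x y && r x y -> @adj (color_class c true) (o x) (o y).
  case/andP=> xy rxy; have /and3P[xn yn _] := xy.
  by rewrite /= /color_adj /= /ladder_graph_adj /= !oK // xy; apply/eqP.
have free : no_matching3 [rel x y | ladder n x y && r x y].
  move=> p q s t u v pq st uv; apply/negP => u6.
  have := no_matching3_of_copy_free no_red (red _ _ pq) (red _ _ st) (red _ _ uv).
  case/negP; rewrite -[[:: _; _; _; _; _; _]]/(map o [:: p; q; s; t; u; v]).
  rewrite map_inj_in_uniq // => x y xS yS oxy.
  have /allP lt : all (fun z => z < n) [:: p; q; s; t; u; v].
    case/andP: pq => /and3P[pn qn _] _; case/andP: st => /and3P[sn tn _] _.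
    case/andP: uv => /and3P[un vn _] _.
    by rewrite /= pn qn sn tn un vn.
  by rewrite -(oK x (lt x xS)) oxy oK ?lt.
have [p [up sp ap pp]] := blue_path ngt symr free.
have lt_p x : x \in p -> x < n by move/allP: ap; apply.
rewrite -sp -(size_map o); apply: (@path_copy (color_class c false) (o 0) (map o p)).
  by rewrite map_inj_in_uniq // => x y /lt_p/oK {2}<- /lt_p/oK {2}<- ->.
rewrite sorted_map; apply: sub_sorted pp => x y /andP[xy rxy].
have /and3P[xn yn _] := xy.
by rewrite /= /color_adj /= /ladder_graph_adj /= !oK // xy; apply/eqP; apply/negbTE.
Qed.

(** Applied to the sizes of connected graphs with the arrow property; as no decision procedure for
    it is given, the minimum is found with excluded middle. *)
Lemma exists_least (P : nat -> Prop) n : P n ->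
  exists2 r, P r & (forall k, P k -> r <= k) /\ r <= n.
Proof.
elim/ltn_ind: n => n IHn Pn.
have [[k [kn Pk]]|minimal] := classic (exists k, k < n /\ P k).
  have [r Pr [rmin rk]] := IHn k kn Pk; exists r => //; split=> //.
  exact: leq_trans rk (ltnW kn).
exists n => //; split=> // k Pk; rewrite leqNgt; apply/negP => kn.
by apply: minimal; exists k.
Qed.

Theorem proposition4p2 (m : nat) (hm : 9 <= m) :
  exists r : nat,
    is_connected_size_ramsey (matching_graph 3) (path_graph m) r /\
    r <= uphalf (3 * m + 7).
Proof.
have ngt : 10 < m + 2 by lia.
have mE : m + 2 - 2 = m by lia.
pose P r := exists F : sgraph, [/\ connected_graph F,
  arrows F (matching_graph 3) (path_graph m) & size_graph F = r].
have PF : P (size_graph (ladder_graph ngt)).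
  exists (ladder_graph ngt); split=> //; first exact: ladder_graph_connected.
  by rewrite -[in path_graph _]mE; apply: ladder_graph_arrows.
have [r Pr [rmin r_le]] := exists_least PF.
exists r; split.
  by split=> // F cF aF; apply: rmin; exists F.
(* For [n = m + 2] the bound [n + n./2 + 1] equals [uphalf (3 * m + 7)], for both parities of
   [m]. *)
have := ladder_graph_size ngt; lia.
Qed.
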